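(* Let $\mu,\nu\in\mathcal{P}(\mathbb{R}^d)$ be absolutely continuous with respect to Lebesgue measure, let $c(x,y)=h(x-y)$ with $h:\mathbb{R}^d\to[0,+\infty)$ strictly convex, and let $\Lambda>0$. Set $\mathcal{E}_{\min}=\inf_{\gamma\in\mathcal{P}(\mathbb{R}^d\times\mathbb{R}^d)}\mathcal{E}_{\Lambda,\mathrm{KL}}(\gamma|\mu,\nu)$. Suppose $\tilde\gamma\in\mathcal{M}(\mathbb{R}^d\times\mathbb{R}^d)$ is the solution to the Entropy Transport problem $\inf_{\gamma\in\mathcal{M}(\mathbb{R}^d\times\mathbb{R}^d)}\mathcal{E}_{\Lambda,\mathrm{KL}}(\gamma|\mu,\nu)$. Then $\tilde\gamma=Z\gamma$, where $Z=e^{-\frac{\mathcal{E}_{\min}}{2\Lambda}}$ and $\gamma\in\mathcal{P}(\mathbb{R}^d\times\mathbb{R}^d)$ is the solution to the constrained Entropy Transport problem $\inf_{\gamma\in\mathcal{P}(\mathbb{R}^d\times\mathbb{R}^d)}\mathcal{E}_{\Lambda,\mathrm{KL}}(\gamma|\mu,\nu)$.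
   Context: $\mathcal{M}(X)$ is the space of finite positive Radon measures on $X$ and $\mathcal{P}(X)$ the space of probability measures on $X$. $\pi_1,\pi_2:\mathbb{R}^d\times\mathbb{R}^d\to\mathbb{R}^d$ are the projections onto the first and second coordinates, and $\#$ denotes push-forward of measures. For finite positive measures $\alpha,\beta$ on $\mathbb{R}^d$, $$D_{\mathrm{KL}}(\alpha\|\beta)=\int_{\mathbb{R}^d}F\left(\frac{d\alpha}{d\beta}\right)d\beta \ \text{ if } \alpha\ll\beta,\qquad D_{\mathrm{KL}}(\alpha\|\beta)=+\infty\ \text{ otherwise},$$ with $F(s)=s\log s-s+1$ (and $F(0)=1$). For $\gamma\in\mathcal{M}(\mathbb{R}^d\times\mathbb{R}^d)$, $$\mathcal{E}_{\Lambda,\mathrm{KL}}(\gamma|\mu,\nu)=\iint_{\mathbb{R}^d\times\mathbb{R}^d}c(x,y)\,d\gamma(x,y)+\Lambda D_{\mathrm{KL}}(\pi_{1\#}\gamma\|\mu)+\Lambda D_{\mathrm{KL}}(\pi_{2\#}\gamma\|\nu).$$ A solution of either problem is a minimizer attaining the infimum over the indicated set. *)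

(* Defs.v *)
From HB Require Import structures.
From mathcomp Require Import all_boot all_order all_algebra.
From mathcomp Require Import all_classical all_reals all_analysis.
From mathcomp Require Import measurable_realfun.

Set Implicit Arguments.
Unset Strict Implicit.
Unset Printing Implicit Defensive.

Import Order.TTheory GRing.Theory Num.Theory.
Import numFieldNormedType.Exports.

Local Open Scope classical_set_scope.
Local Open Scope ring_scope.
Local Open Scope ereal_scope.
Local Open Scope charge_scope.

Definition rV_display : measure_display. Proof. exact. Qed.

(* The Borel sigma-algebra of R^d = 'rV[R]_d. The product sigma-algebra put by
   the library on 'rV[R]_d * 'rV[R]_d is then the Borel one, the spaces being
   second countable. As every finite Borel measure on R^d is Radon,
   {finite_measure set _ -> \bar R} is the space of finite positive Radon
   measures. *)
Section borel_rV.
Context (R : realType) (d : nat).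

Let borel : set (set 'rV[R]_d) := <<s open >>.

Let borel0 : borel set0.
Proof. exact: sigma_algebra0. Qed.

Let borelC A : borel A -> borel (~` A).
Proof. exact: sigma_algebraC. Qed.

Let borel_bigcup (F : (set 'rV[R]_d)^nat) :
  (forall i, borel (F i)) -> borel (\bigcup_i F i).
Proof. exact: sigma_algebra_bigcup. Qed.

HB.instance Definition _ := @isMeasurable.Build rV_display 'rV[R]_d
  borel borel0 borelC borel_bigcup.

Lemma measurable_rVE : @measurable _ 'rV[R]_d = <<s open >>.
Proof. by []. Qed.

End borel_rV.

Section measurable_rV.
Context (R : realType).

Lemma measurable_rV_coord d (i : 'I_d) :
  measurable_fun [set: 'rV[R]_d] (fun v => v ord0 i).
Proof.
apply: (measurability _ (RGenOpens.measurableE R)).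
move=> _ [_ [a [b ->]] <-]; rewrite setTI; apply: sub_sigma_algebra.
have /continuousP := @coord_continuous R 1 d ord0 i; apply.
exact: interval_open.
Qed.

Lemma measurable_fun_rV d disp (T : measurableType disp) (f : T -> 'rV[R]_d) :
  (forall i, measurable_fun setT (fun x => f x ord0 i)) -> measurable_fun setT f.
Proof.
move=> mf; apply: (measurability _ (@measurable_rVE R d)) => _ [A oA <-].
pose rV (q : 'rV[rat]_d) : 'rV[R]_d := \row_j ratr (q ord0 j).
pose B (qn : 'rV[rat]_d * nat) := ball (rV qn.1) qn.2.+1%:R^-1.
pose C qn := if pselect (B qn `<=` A) then B qn else set0.
have -> : A = \bigcup_qn C qn.
  apply/seteqP; split=> [v Av|v [qn _]]; last first.
    by rewrite /C; case: pselect => // BA; exact: BA.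
  have /nbhs_ballP[e /= e0 veA] : nbhs v A by exact: open_nbhs_nbhs.
  have e20 : (0 < e / 2)%R by rewrite divr_gt0.
  have [n _ /(_ n (leqnn n)) /= ne] := near_infty_natSinv_lt (PosNum e20).
  have n0 : (0 < n.+1%:R^-1 :> R)%R by rewrite invr_gt0.
  have /choice[q vq] : forall j, exists q : rat,
      ball (v ord0 j) n.+1%:R^-1 (ratr q : R).
    move=> j; have [| |x [vx [q _ qx]]] := @dense_rat R (ball (v ord0 j) n.+1%:R^-1).
    - by exists (v ord0 j); exact: ballxx.
    - exact: ball_open.
    - by exists q; rewrite qx.
  have vball : ball v n.+1%:R^-1 (rV (\row_j q j)).
    by split=> // i j; rewrite ord1 !mxE; exact: vq.
  exists (\row_j q j, n) => //; rewrite /C; case: pselect => [?|nBA].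
    exact: ball_sym.
  exfalso; apply: nBA => w /= qw; apply: veA; rewrite (splitr e).
  apply: ball_triangle; first by apply: le_ball vball; exact: ltW.
  by apply: le_ball qw; exact: ltW.
rewrite setTI preimage_bigcup; apply: countable_bigcupT_measurable => // qn.
rewrite /C; case: pselect => ?; last by rewrite preimage_set0.
have -> : f @^-1` B qn = \bigcap_(j in [set: 'I_d])
    ((fun x => f x ord0 j) @^-1` ball (rV qn.1 ord0 j) qn.2.+1%:R^-1).
  apply/seteqP; split=> [x [_ fx] j _|x fx]; first exact: fx.
  by split=> [|i j]; [rewrite invr_gt0|rewrite ord1; exact: fx].
apply: fin_bigcap_measurable => // j _.
rewrite -[X in measurable X]setTI; apply: mf => //.
exact: measurable_ball.
Qed.

Definition rV_cons d (p : R * 'rV[R]_d) : 'rV[R]_d.+1 :=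
  row_mx (p.1)%:M p.2.

Lemma rV_cons0 d (p : R * 'rV[R]_d) : rV_cons p ord0 ord0 = p.1.
Proof.
rewrite /rV_cons (_ : ord0 = lshift d (ord0 : 'I_1)); last exact: val_inj.
by rewrite (@row_mxEl _ 1 1 d) mxE eqxx mulr1n.
Qed.

Lemma rV_consS d (p : R * 'rV[R]_d) i :
  rV_cons p ord0 (lift ord0 i) = p.2 ord0 i.
Proof.
rewrite /rV_cons (_ : lift ord0 i = rshift 1 i); last exact: val_inj.
by rewrite (@row_mxEr _ 1 1 d).
Qed.

Lemma measurable_rV_cons d : measurable_fun setT (@rV_cons d).
Proof.
apply: measurable_fun_rV => i; case: (unliftP ord0 i) => [j|] ->.
  under eq_fun do rewrite rV_consS.
  exact: (measurableT_comp (measurable_rV_coord j)).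
under eq_fun do rewrite rV_cons0.
exact: measurable_fst.
Qed.

Definition rV_uncons d (v : 'rV[R]_d.+1) : R * 'rV[R]_d :=
  (v ord0 ord0, \row_j v ord0 (lift ord0 j)).

Lemma rV_consK d : cancel (@rV_cons d) (@rV_uncons d).
Proof.
move=> [x v]; rewrite /rV_uncons rV_cons0; congr pair.
by apply/rowP => j; rewrite mxE rV_consS.
Qed.

Lemma measurable_rV_uncons d : measurable_fun setT (@rV_uncons d).
Proof.
apply/measurable_fun_pairP; split; first exact: measurable_rV_coord.
apply: measurable_fun_rV => i; rewrite /=.
under eq_fun do rewrite mxE.
exact: measurable_rV_coord.
Qed.

End measurable_rV.

Section lebesgue_rVS.
Context (R : realType) (d : nat).
Variable nu : {sigma_finite_measure set 'rV[R]_d -> \bar R}.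

Definition lebesgue_rVS : set 'rV[R]_d.+1 -> \bar R :=
  pushforward (@lebesgue_measure R \x nu) (@rV_cons R d).

Let mf : measurable_fun setT (@rV_cons R d).
Proof. exact: measurable_rV_cons. Qed.

Let lebesgue_rVS0 : lebesgue_rVS set0 = 0.
Proof. exact: measure0. Qed.

Let lebesgue_rVS_ge0 A : 0 <= lebesgue_rVS A.
Proof. exact: measure_ge0. Qed.

Let lebesgue_rVS_sigma_additive : semi_sigma_additive lebesgue_rVS.
Proof. exact: measure_semi_sigma_additive. Qed.

HB.instance Definition _ := isMeasure.Build _ _ _ lebesgue_rVS
  lebesgue_rVS0 lebesgue_rVS_ge0 lebesgue_rVS_sigma_additive.

Let lebesgue_rVS_sigma_finite : sigma_finite setT lebesgue_rVS.
Proof.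
have /sigma_finiteP[F [FT ndF Foo]] := sigma_finiteT (@lebesgue_measure R).
have /sigma_finiteP[G [GT ndG Goo]] := sigma_finiteT nu.
exists (fun n => @rV_uncons R d @^-1` (F n `*` G n)).
  apply/esym/seteqP; split => // v _.
  have [n _ Fn] : (\bigcup_n F n) (v ord0 ord0) by rewrite -FT.
  have [k _ Gk] : (\bigcup_n G n) (rV_uncons v).2 by rewrite -GT.
  exists (maxn n k) => //; split.
    by move: Fn; exact/subsetPset/ndF/leq_maxl.
  by move: Gk; exact/subsetPset/ndG/leq_maxr.
move=> n; have [mF Fn] := Foo n; have [mG Gn] := Goo n; split.
  rewrite -[X in measurable X]setTI; apply: measurable_rV_uncons => //.
  exact: measurableX.
rewrite /lebesgue_rVS /pushforward -comp_preimage.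
rewrite (_ : _ \o _ = id); last by apply/funext => p; exact: rV_consK.
by rewrite product_measure1E// lte_mul_pinfty// ge0_fin_numE.
Qed.

HB.instance Definition _ := Measure_isSigmaFinite.Build _ _ _ lebesgue_rVS
  lebesgue_rVS_sigma_finite.

End lebesgue_rVS.

(* d-dimensional Lebesgue measure: R^0 is a point of mass 1, and R^d.+1 is
   R * R^d with the product measure, transported by rV_cons. *)
Fixpoint lebesgue_rV (R : realType) (d : nat) :
    {sigma_finite_measure set 'rV[R]_d -> \bar R} :=
  match d with
  | 0 => @dirac _ _ (0%R : 'rV[R]_0) R
  | d'.+1 => lebesgue_rVS (lebesgue_rV R d')
  end.

Lemma lebesgue_rV_box (R : realType) (d : nat) (A : 'I_d -> set R) :
  (forall i, measurable (A i)) ->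
  lebesgue_rV R d [set v : 'rV[R]_d | forall i, A i (v ord0 i)] =
  \prod_(i < d) lebesgue_measure (A i).
Proof.
elim: d A => [|d IH] A mA.
  by rewrite big_ord0 /= diracE mem_set// => -[].
rewrite big_ord_recl -IH; last by move=> i; exact: mA.
rewrite -product_measure1E; first last.
- rewrite (_ : mkset _ = \bigcap_(i in [set: 'I_d])
    ((fun v : 'rV[R]_d => v ord0 i) @^-1` A (lift ord0 i))).
    apply: fin_bigcap_measurable => // i _; rewrite -[X in measurable X]setTI.
    by apply: measurable_rV_coord => //; exact: mA.
  by apply/seteqP; split => [v /= Av i _|v /= Av i]; exact: Av.
- exact: mA.
rewrite /= /lebesgue_rVS /pushforward.
apply: (congr1 (@lebesgue_measure R \x lebesgue_rV R d)).
apply/seteqP; split => [p /= Ap|p /= [Ap0 ApS] i].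
  split; first by have := Ap ord0; rewrite rV_cons0.
  by move=> i; have := Ap (lift ord0 i); rewrite rV_consS.
by case: (unliftP ord0 i) => [j|] ->; rewrite ?rV_consS ?rV_cons0.
Qed.

Section kullback_leibler.
Context (R : realType).

(* [ln] is 0 outside the positive reals; see entropy_fun0 for the value at 0. *)
Definition entropy_fun (s : R) : R := (s * ln s - s + 1)%R.

Lemma entropy_fun0 : entropy_fun 0 = 1%R.
Proof. by rewrite /entropy_fun mul0r subr0 add0r. Qed.

(* The Radon-Nikodym derivative is finite valued when alpha `<< beta, so [fine]
   loses nothing. *)
Definition KL disp (T : measurableType disp)
    (alpha beta : {finite_measure set T -> \bar R}) : \bar R :=
  if `[< alpha `<< beta >] then
    \int[beta]_x
      (entropy_fun (fine (('d (charge_of_finite_measure alpha) '/d beta) x)))%:E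
  else +oo.

End kullback_leibler.

Section marginals.
Context disp1 disp2 (T1 : measurableType disp1) (T2 : measurableType disp2).
Context (R : realType) (gamma : {finite_measure set (T1 * T2)%type -> \bar R}).

Definition marginal1 : set T1 -> \bar R := pushforward gamma fst.
Definition marginal2 : set T2 -> \bar R := pushforward gamma snd.

Let mfst : measurable_fun [set: (T1 * T2)%type] fst. Proof. by []. Qed.
Let msnd : measurable_fun [set: (T1 * T2)%type] snd. Proof. by []. Qed.

Let marginal1_0 : marginal1 set0 = 0.
Proof. exact: measure0. Qed.

Let marginal1_ge0 A : 0 <= marginal1 A.
Proof. exact: measure_ge0. Qed.

Let marginal1_sigma_additive : semi_sigma_additive marginal1.
Proof. exact: measure_semi_sigma_additive. Qed.

HB.instance Definition _ := isMeasure.Build _ _ _ marginal1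
  marginal1_0 marginal1_ge0 marginal1_sigma_additive.

Let marginal2_0 : marginal2 set0 = 0.
Proof. exact: measure0. Qed.

Let marginal2_ge0 A : 0 <= marginal2 A.
Proof. exact: measure_ge0. Qed.

Let marginal2_sigma_additive : semi_sigma_additive marginal2.
Proof. exact: measure_semi_sigma_additive. Qed.

HB.instance Definition _ := isMeasure.Build _ _ _ marginal2
  marginal2_0 marginal2_ge0 marginal2_sigma_additive.

Let marginal1_fin : fin_num_fun marginal1.
Proof.
move=> A mA; apply: fin_num_measure; rewrite -[X in measurable X]setTI.
exact: measurable_fst.
Qed.

Let marginal2_fin : fin_num_fun marginal2.
Proof.
move=> A mA; apply: fin_num_measure; rewrite -[X in measurable X]setTI.
exact: measurable_snd.
Qed.

HB.instance Definition _ := Measure_isFinite.Build _ _ _ marginal1 marginal1_fin.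
HB.instance Definition _ := Measure_isFinite.Build _ _ _ marginal2 marginal2_fin.

End marginals.

Section entropy_transport.
Context (R : realType) (d : nat).

Definition entropy_transport (c : 'rV[R]_d -> 'rV[R]_d -> R) (Lambda : R)
    (mu nu : {finite_measure set 'rV[R]_d -> \bar R})
    (gamma : {finite_measure set ('rV[R]_d * 'rV[R]_d)%type -> \bar R}) : \bar R :=
  (\int[gamma]_z (c z.1 z.2)%:E)
  + Lambda%:E * KL (marginal1 gamma) mu
  + Lambda%:E * KL (marginal2 gamma) nu.

Definition strictly_convex (h : 'rV[R]_d -> R) : Prop :=
  forall (x y : 'rV[R]_d) (t : R), x <> y -> (0 < t < 1)%R ->
    (h (t *: x + (1 - t) *: y) < t * h x + (1 - t) * h y)%R.

End entropy_transport.

Definition is_minimizer (R : realType) (I : Type) (E : I -> \bar R) (g : I) :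
  Prop := E g = ereal_inf (range E).

(* Main.v *)
(* A measure with mass s is s times a probability gamma, and scaling the
   marginals gives
     E(s gamma) = s E(gamma) + 2 Lambda (s log s + 1 - s).
   For E(gamma) = a finite, this is minimal exactly at s = exp(- a / (2 Lambda)),
   with value 2 Lambda (1 - exp(- a / (2 Lambda))), an increasing function of a.
   Hence the normalization of a minimizer over all measures minimizes E over
   probabilities, and its mass is the optimal s for a = Emin. For the uniqueness
   of gamma, Emin must be finite (otherwise every probability is a minimizer):
   the convex h is bounded on bounded sets, so the product of mu and nu
   conditioned on large boxes has finite energy. *)

Require Import Defs.
From mathcomp Require Import all_boot all_order all_algebra.
From mathcomp Require Import all_classical all_reals all_analysis.
From mathcomp Require Import measurable_realfun.
From mathcomp Require Import ring lra.

Set Implicit Arguments.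
Unset Strict Implicit.
Unset Printing Implicit Defensive.

Import Order.TTheory GRing.Theory Num.Theory.
Import numFieldNormedType.Exports.

Local Open Scope classical_set_scope.
Local Open Scope ring_scope.
Local Open Scope ereal_scope.

(** * Convex functions: local boundedness, continuity, measurability *)

Section convex.
Local Open Scope ring_scope.
Context (R : realType) (d : nat) (h : 'rV[R]_d -> R).
Hypotheses (h_ge0 : forall z, 0 <= h z) (h_convex : strictly_convex h).

Lemma strictly_convex_le (x y : 'rV[R]_d) (t : R) : 0 <= t <= 1 ->
  h (t *: x + (1 - t) *: y) <= t * h x + (1 - t) * h y.
Proof.
move=> /andP[t0 t1]; have [->|/eqP xy] := eqVneq x y.
  by rewrite -scalerDl -mulrDl addrC subrK scale1r mul1r.
move: t0; rewrite le_eqVlt => /predU1P[<-|t0].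
  by rewrite scale0r mul0r !add0r subr0 scale1r mul1r.
move: t1; rewrite le_eqVlt => /predU1P[->|t1].
  by rewrite subrr scale0r mul0r !addr0 scale1r mul1r.
by apply/ltW/h_convex => //; rewrite t0.
Qed.

Lemma strictly_convex_le_add (x y : 'rV[R]_d) (t : R) : 0 <= t <= 1 ->
  h (t *: x + (1 - t) *: y) <= h x + h y.
Proof.
move=> t01; apply: (le_trans (strictly_convex_le x y t01)).
have := h_ge0 x; have := h_ge0 y; case/andP: t01 => *; nra.
Qed.

(** Induction on the number [k] of coordinates allowed to be nonzero. Splitting off one coordinate
    by a midpoint doubles the others, so the radius [s] varies in the induction. *)
Lemma strictly_convex_bounded (r : R) : 0 < r ->
  exists M, forall v : 'rV[R]_d, (forall i, `|v ord0 i| <= r) -> h v <= M.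
Proof.
move=> r0.
suff /(_ d r r0) [M hM] : forall (k : nat) (s : R), 0 < s -> exists M,
    forall v : 'rV[R]_d,
    (forall i, `|v ord0 i| <= s) ->
    (forall i : 'I_d, (k <= i)%N -> v ord0 i = 0) ->
    h v <= M.
  by exists M => v vr; apply: hM => // i; rewrite leqNgt ltn_ord.
elim=> [|k IH] s s0.
  exists (h 0) => v _ v0; suff -> : v = 0 by [].
  by apply/rowP => i; rewrite mxE v0.
have [M hM] := IH (2 * s) (mulr_gt0 (ltr0n _ 2) s0).
case: (ltnP k d) => [kd|dk]; last first.
  exists M => v vs v0; apply: hM => [i|i ki].
    by apply: (le_trans (vs i)); rewrite ler_peMl ?ler1n// ltW.
  by have := leq_ltn_trans (leq_trans dk ki) (ltn_ord i); rewrite ltnn.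
pose e : 'rV[R]_d := delta_mx ord0 (Ordinal kd).
exists (M + (h ((2 * s) *: e) + h (- (2 * s) *: e))) => v vs v0.
pose a := v ord0 (Ordinal kd); pose w := v - a *: e.
(* [v] is the midpoint of [2 *: w], whose coordinate of index [k] vanishes, and of a point on the
   axis of [e]. *)
have -> : v = 2^-1 *: (2 *: w) + (1 - 2^-1) *: ((2 * a) *: e).
  rewrite !scalerA mulVf ?pnatr_eq0// scale1r.
  by rewrite (_ : (1 - 2^-1) * (2 * a) = a) ?subrK//; field.
have half01 : 0 <= 2^-1 :> R /\ 2^-1 <= 1 :> R by lra.
apply: (le_trans (strictly_convex_le_add _ _ (introT andP half01))); apply: lerD.
  apply: hM => i; rewrite !mxE eqxx /=.
    rewrite normrM ger0_norm// ler_pM2l//.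
    have [->|_] := eqVneq i (Ordinal kd); first by rewrite mulr1 subrr normr0 ltW.
    by rewrite mulr0 subr0.
  move=> ki; have [->|ik] := eqVneq i (Ordinal kd).
    by rewrite mulr1 subrr mulr0.
  rewrite mulr0 subr0 v0 ?mulr0// ltn_neqAle ki andbT eq_sym.
  by apply: contra ik => /eqP ik; apply/eqP/val_inj.
have := vs (Ordinal kd); rewrite -/a ler_norml => /andP[as1 as2].
(* As [a] lies between [- s] and [s], this point is on the segment joining two fixed points of the
   axis. *)
have -> : (2 * a) *: e = ((a / s + 1) / 2) *: ((2 * s) *: e) +
    (1 - (a / s + 1) / 2) *: (- (2 * s) *: e).
  by rewrite !scalerA -scalerDl; congr (_ *: _); field; rewrite gt_eqF.
apply: strictly_convex_le_add.
have : -1 <= a / s <= 1 by rewrite ler_pdivlMr// ler_pdivrMr// mulN1r mul1r as1.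
by move=> /andP[? ?]; apply/andP; split; lra.
Qed.

(** Local boundedness suffices: [y] lies between [x] and [x + u], while [x] lies between [x - u] and
    [y], with [u] in the unit box. Convexity on these two segments bounds the distance of [h x] to
    [h y] by [t * M]. *)
Lemma strictly_convex_continuous : continuous h.
Proof.
move=> x; pose r := 1 + \sum_i `|x ord0 i|.
have xr i : `|x ord0 i| + 1 <= r.
  rewrite /r addrC lerD2l (bigD1 i)//= lerDl; exact: sumr_ge0.
have r0 : 0 < r by rewrite ltr_pwDl// sumr_ge0.
have [M hM] := strictly_convex_bounded r0.
have M0 : 0 <= M.
  by apply: le_trans (h_ge0 0) (hM _ _) => i; rewrite mxE normr0 ltW.
have := nbhs_filter x => Fx; apply/(@cvgrPdist_le _ _ _ (nbhs x)) => /= e e0.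
pose t := e / (e + M + 1).
have t0 : 0 < t by rewrite divr_gt0//; lra.
have t1 : t <= 1 by rewrite ler_pdivrMr; lra.
have tM : t * M <= e by rewrite mulrAC ler_pdivrMr; nra.
apply/nbhs_ballP; exists t => //= y [_ xy].
pose u := t^-1 *: (y - x).
have u1 i : `|u ord0 i| <= 1.
  rewrite !mxE normrM gtr0_norm ?invr_gt0// mulrC ler_pdivrMr// mul1r distrC.
  by apply/ltW; exact: (xy ord0 i).
have hxu : h (x + u) <= M.
  apply: hM => i; rewrite mxE (le_trans (ler_normD _ _))//.
  by rewrite (le_trans _ (xr i))// lerD2l.
have hxNu : h (x - u) <= M.
  apply: hM => i; rewrite 2!mxE (le_trans (ler_normB _ _))//.
  by rewrite (le_trans _ (xr i))// lerD2l.
have yE : y = t *: (x + u) + (1 - t) *: x.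
  by apply/rowP => i; rewrite !mxE; field; rewrite gt_eqF.
have xE : x = (1 + t)^-1 *: y + (1 - (1 + t)^-1) *: (x - u).
  apply/rowP => i; rewrite !mxE; field.
  by rewrite !gt_eqF//; lra.
have hy : h y <= t * h (x + u) + (1 - t) * h x.
  by rewrite {1}yE; apply: strictly_convex_le; lra.
have hx : h x <= (1 + t)^-1 * h y + (1 - (1 + t)^-1) * h (x - u).
  rewrite {1}xE; apply: strictly_convex_le.
  by rewrite invr_ge0 invf_le1; lra.
have {}hx : (1 + t) * h x <= h y + t * h (x - u).
  move: hx; rewrite -(ler_pM2l (_ : 0 < 1 + t)); last by lra.
  by rewrite mulrDr !mulrA mulrBr mulr1 divff ?gt_eqF ?mul1r; lra.
have := h_ge0 x; have := h_ge0 y; rewrite ler_norml; nra.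
Qed.

Lemma measurable_strictly_convex : measurable_fun setT h.
Proof.
apply: (measurability _ (RGenOpens.measurableE R)).
move=> _ [_ [a [b ->]] <-]; rewrite setTI; apply: sub_sigma_algebra.
have /continuousP := strictly_convex_continuous; apply.
exact: interval_open.
Qed.

End convex.

(** * Additivity of the integral with a signed integrable term *)

Section integral.
Context disp (T : measurableType disp) (R : realType).
Variable mu : {measure set T -> \bar R}.

(** If [f] is not integrable, neither is [f + g], and both sides are [+oo]. This covers infinite
    relative entropies in [KLZ]. *)
Lemma ge0_integralD_integrable (f g : T -> R) :
  measurable_fun setT f -> (forall x, 0 <= f x)%R ->
  mu.-integrable setT (EFin \o g) -> (forall x, 0 <= f x + g x)%R ->
  \int[mu]_x (f x + g x)%:E = \int[mu]_x (f x)%:E + \int[mu]_x (g x)%:E.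
Proof.
move=> mf f0 ig fg0.
have [fi|fi] := pselect (mu.-integrable setT (EFin \o f)).
  by under eq_integral do rewrite EFinD; rewrite integralD.
have mg : measurable_fun setT g.
  by apply/measurable_EFinP; exact: measurable_int ig.
have oo (u : T -> R) : measurable_fun setT u -> (forall x, 0 <= u x)%R ->
    ~ mu.-integrable setT (EFin \o u) -> \int[mu]_x (u x)%:E = +oo.
  move=> mf' u0 ui; apply/eqP; rewrite eq_le leey leNgt.
  apply: contra_notN ui => uoo.
  apply/integrableP; split; first exact/measurable_EFinP.
  by under eq_integral do rewrite /= ger0_norm//.
rewrite (oo f)// addye; last first.
  by have := integrable_fin_num measurableT ig; rewrite fin_numE => /andP[].
apply: (oo (fun x => f x + g x)%R) => //; first exact: measurable_funD.
move=> fgi; apply: fi; have := integrableB measurableT fgi ig.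
by congr (_.-integrable _ _); apply/funext => x /=; rewrite -EFinB addrK.
Qed.

End integral.

(** * Relative entropy: densities and scaling *)

Section KL.
Context disp (T : measurableType disp) (R : realType).
Implicit Types alpha beta : {finite_measure set T -> \bar R}.

(** This is the strict inequality [1 + x < expR x] at [x = - ln s], multiplied by [s]. For [s <= 0]
    the convention [ln s = 0] leaves [1 - s]. *)
Lemma entropy_fun_gt0 (s : R) : s != 1%R -> (0 < entropy_fun s)%R.
Proof.
rewrite /entropy_fun => s1; have [s0|s0] := leP s 0%R; first by rewrite ln0//; lra.
have : (1 - ln s < s^-1)%R.
  by rewrite -{2}(lnK s0) -expRN expR_gt1Dx// oppr_eq0 ln_eq0.
rewrite -(ltr_pM2l s0) divff ?gt_eqF//; lra.
Qed.

Lemma entropy_fun1 : entropy_fun 1%R = 0%R :> R.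
Proof. by rewrite /entropy_fun ln1 mulr0 sub0r addNr. Qed.

Lemma entropy_fun_ge0 (s : R) : (0 <= entropy_fun s)%R.
Proof.
by have [->|/entropy_fun_gt0/ltW//] := eqVneq s 1%R; rewrite entropy_fun1.
Qed.

Lemma measurable_entropy_fun : measurable_fun setT (@entropy_fun R).
Proof.
apply: measurable_funD => //; apply: measurable_funB => //.
by apply: measurable_funM => //; exact: measurable_ln.
Qed.

(** The grouping separates a nonnegative term, possibly of infinite integral, from a remainder
    affine in [x]. *)
Lemma entropy_funZ (s x : R) : (0 < s)%R -> (0 <= x)%R ->
  entropy_fun (s * x) = (s * entropy_fun x + (s * ln s * x + (1 - s)))%R.
Proof.
move=> s0; rewrite le_eqVlt /entropy_fun => /predU1P[<-|x0]; first by ring.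
by rewrite lnM ?posrE//; ring.
Qed.

Lemma KL_ge0 alpha beta : 0 <= KL alpha beta.
Proof.
rewrite /KL; case: ifPn => // _; apply: integral_ge0 => x _.
by rewrite lee_fin entropy_fun_ge0.
Qed.

Lemma density_dominates alpha beta (f : T -> R) :
  (forall A, measurable A -> alpha A = \int[beta]_(x in A) (f x)%:E) ->
  measurable_fun setT f ->
  alpha `<< beta.
Proof.
move=> alphaE mf; apply/null_content_dominatesP => A mA A0.
rewrite alphaE// null_set_integral//.
by apply/measurable_EFinP; exact: measurable_funTS.
Qed.

(** Frees computations from the derivative chosen in [KL]: two densities with the same integrals
    over measurable sets agree almost everywhere. *)
Lemma KL_density alpha beta (f : T -> R) :
  measurable_fun setT f -> (forall x, 0 <= f x)%R ->
  (forall A, measurable A -> alpha A = \int[beta]_(x in A) (f x)%:E) ->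
  KL alpha beta = \int[beta]_x (entropy_fun (f x))%:E.
Proof.
move=> mf f0 alphaE; have ab := density_dominates alphaE mf.
rewrite /KL asboolT//.
have dE : ae_eq beta setT
    (Radon_Nikodym (charge_of_finite_measure alpha) beta) (EFin \o f).
  apply: integral_ae_eq => //; first exact: Radon_Nikodym_integrable.
    exact/measurable_EFinP.
  by move=> A _ mA; rewrite -Radon_Nikodym_integral// -alphaE.
apply: ae_eq_integral => //.
- apply/measurable_EFinP; apply: measurableT_comp; first exact: measurable_entropy_fun.
  apply: measurableT_comp => //.
- apply/measurable_EFinP; apply: measurableT_comp => //.
  exact: measurable_entropy_fun.
- by apply: filterS dE => x /= /[apply] ->.
Qed.

Lemma dominates_density alpha beta : alpha `<< beta ->
  exists f : T -> R, [/\ measurable_fun setT f, (forall x, 0 <= f x)%R,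
    beta.-integrable setT (EFin \o f) &
    forall A, measurable A -> alpha A = \int[beta]_(x in A) (f x)%:E].
Proof.
move=> ab; have [f [f0 ffin fi alphaE]] := radon_nikodym_sigma_finite ab.
have fE : EFin \o (fine \o f) = f by apply/funext => x /=; rewrite fineK.
exists (fine \o f); split.
- by apply/measurable_EFinP; rewrite fE; exact: measurable_int fi.
- by move=> x; apply: fine_ge0.
- by rewrite fE.
- by move=> A mA; rewrite alphaE//; apply: eq_integral => x _; rewrite /= fineK.
Qed.

(** Integrate [entropy_funZ] against [beta]: the unit masses turn the affine remainder into a
    constant. *)
Lemma KLZ alpha alpha' beta (s : R) : (0 <= s)%R ->
  alpha setT = 1 -> beta setT = 1 ->
  (forall A, measurable A -> alpha' A = s%:E * alpha A) ->
  KL alpha' beta = s%:E * KL alpha beta + (s * ln s + 1 - s)%:E.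
Proof.
move=> s0 alpha1 beta1 alpha'E; move: s0; rewrite le_eqVlt => /predU1P[s0|s0].
  (* For [s = 0] the density is 0 and [entropy_fun 0 = 1]; the product of 0 and [KL alpha beta] is 0
     even if the latter is infinite. *)
  rewrite -s0 mul0e mul0r add0r subr0 (@KL_density _ _ (cst 0%R))//=.
    by rewrite entropy_fun0 integral_cst// [X in _ * X]beta1 mule1 ?add0r.
  by move=> A mA; rewrite alpha'E// -s0 mul0e integral0.
(* Since [s > 0], both measures have the same null sets, so without domination both sides are
   [+oo]. *)
have [ab|nab] := pselect (alpha `<< beta); last first.
  rewrite /KL !asboolF// => [|a'b]; first by rewrite gt0_muley ?lte_fin.
  apply: nab; apply/null_content_dominatesP => A mA A0.
  move/null_content_dominatesP : a'b => /(_ A mA A0); rewrite alpha'E//.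
  by move/eqP; rewrite mule_eq0 eqe gt_eqF//= => /eqP.
have [f [mf f0 fi alphaE]] := dominates_density ab.
rewrite (KL_density mf f0 alphaE) (@KL_density _ _ (fun x => s * f x)%R).
- under eq_integral do rewrite entropy_funZ//.
  have mF : measurable_fun setT (fun x => entropy_fun (f x)).
    by apply: measurableT_comp => //; exact: measurable_entropy_fun.
  have fi1 : beta.-integrable setT (fun x => (s * ln s)%:E * (f x)%:E).
    exact: integrableZl.
  have fi2 : beta.-integrable setT (cst (1 - s)%:E).
    exact: finite_measure_integrable_cst.
  rewrite ge0_integralD_integrable//; last first.
  + by move=> x; rewrite -entropy_funZ// entropy_fun_ge0.
  + have := integrableD measurableT fi1 fi2; congr (_.-integrable _ _).
  + by move=> x; rewrite mulr_ge0 ?entropy_fun_ge0 ?ltW.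
  + exact: measurable_funM.
  congr (_ + _).
    under eq_integral do rewrite EFinM.
    rewrite ge0_integralZl//; first exact/measurable_EFinP.
    - by move=> x _; rewrite lee_fin entropy_fun_ge0.
    - by rewrite lee_fin ltW.
  under eq_integral do rewrite EFinD EFinM.
  rewrite integralD// integralZl// integral_cst// -alphaE// alpha1.
  rewrite [X in _ + _ * X]beta1.
  by rewrite !mule1 -EFinD addrA.
- exact: measurable_funM.
- by move=> x; rewrite mulr_ge0// ltW.
- move=> A mA; rewrite alpha'E// alphaE//.
  under [RHS]eq_integral do rewrite EFinM.
  rewrite integralZl//.
  by apply: (integrableS measurableT mA _ fi).
Qed.

(** The case [s = 1] of [KLZ]. The two measures may differ as set functions outside the
    sigma-algebra. *)
Lemma eq_KL alpha alpha' beta : alpha setT = 1 -> beta setT = 1 ->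
  (forall A, measurable A -> alpha' A = alpha A) ->
  KL alpha' beta = KL alpha beta.
Proof.
move=> alpha1 beta1 alpha'E; rewrite (@KLZ alpha _ _ 1%R)//.
  by rewrite mul1e ln1 mulr0 add0r subrr adde0.
by move=> A mA; rewrite mul1e alpha'E.
Qed.

End KL.

(** * Conditioning a probability on an event *)

Section conditioning.
Context disp (T : measurableType disp) (R : realType) (P : probability T R).

(** The conditional law has density [r = 1 / P B] on [B] and 0 elsewhere, so the entropy integrand
    takes only the values [entropy_fun r] and 1, both at most [entropy_fun r + 1]. *)
Lemma probability_condition_KL (B : set T) : measurable B -> 0 < P B ->
  exists2 Q : probability T R, Q B = 1 & KL Q P < +oo.
Proof.
move=> mB B0; have PBfin : P B \is a fin_num by exact: fin_num_measure.
pose r := (fine (P B))^-1%R.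
have r0 : (0 <= r)%R by rewrite invr_ge0 fine_ge0.
pose Q : probability T R := mnormalize (mrestr P mB) P.
have QE A : Q A = r%:E * P (A `&` B).
  have PT : mrestr P mB setT = P B by rewrite /mrestr setTI.
  have PBoo : P B < +oo by rewrite ltey_eq PBfin.
  rewrite /Q /= /mnormalize /= PT gt_eqF//= lt_eqF//= muleC.
  by rewrite /r /mrestr.
exists Q.
  by rewrite QE setIid /r -{2}(fineK PBfin) -EFinM mulVf ?fine_eq0 ?gt_eqF.
have mf : measurable_fun setT (fun x => r * \1_B x)%R by exact: measurable_funM.
rewrite (@KL_density _ _ _ _ _ (fun x => r * \1_B x)%R)//; first last.
- move=> A mA; rewrite [LHS]QE; under eq_integral do rewrite EFinM.
  rewrite ge0_integralZl//; last exact/measurable_EFinP/measurable_funTS.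
  by rewrite integral_indic// setIC.
- by move=> x; rewrite mulr_ge0.
apply: (@le_lt_trans _ _ (\int[P]_x (entropy_fun r + 1)%:E)); last first.
  by rewrite integral_cst// [X in _ * X]probability_setT mule1 ltry.
apply: ge0_le_integral => //.
- by move=> x _; rewrite lee_fin entropy_fun_ge0.
- apply/measurable_EFinP; apply: measurableT_comp => //.
  exact: measurable_entropy_fun.
- move=> x _; rewrite lee_fin indicE; case: (x \in B).
    by rewrite mulr1 lerDl.
  by rewrite mulr0 entropy_fun0 lerDr entropy_fun_ge0.
Qed.

End conditioning.

(** * Energy of a multiple of a probability *)

Section transport.
Context (R : realType) (d : nat).
Local Notation V := 'rV[R]_d.
Variables (mu nu : probability V R) (c : V -> V -> R) (Lambda : R).
Hypotheses (c_ge0 : forall x y, (0 <= c x y)%R) (Lambda_gt0 : (0 < Lambda)%R).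
Hypothesis mc : measurable_fun setT (fun z : V * V => c z.1 z.2).

Local Notation E := (entropy_transport c Lambda mu nu).

Lemma entropy_transport_ge0 (g : {finite_measure set (V * V)%type -> \bar R}) :
  0 <= E g.
Proof.
apply: adde_ge0; first apply: adde_ge0.
- by apply: integral_ge0 => z _; rewrite lee_fin.
- by rewrite mule_ge0 ?KL_ge0// lee_fin ltW.
- by rewrite mule_ge0 ?KL_ge0// lee_fin ltW.
Qed.

(** The cost is linear in the measure, and both marginals of [g] are probabilities, so [KLZ] applies
    twice. *)
Lemma entropy_transportZ (g : probability (V * V)%type R)
    (g' : {finite_measure set (V * V)%type -> \bar R}) (s : R) : (0 <= s)%R ->
  (forall A, measurable A -> g' A = s%:E * g A) ->
  E g' = s%:E * E g + (2 * Lambda * (s * ln s + 1 - s))%:E.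
Proof.
move=> s0 g'E; pose k := NngNum s0.
have cE : \int[g']_z (c z.1 z.2)%:E = s%:E * \int[g]_z (c z.1 z.2)%:E.
  rewrite (@eq_measure_integral _ _ _ _ (mscale k g)).
    rewrite ge0_integral_mscale//; first exact/measurable_EFinP.
    by move=> z _; rewrite lee_fin.
  by move=> A mA _; rewrite [LHS]g'E.
have K1 : KL (marginal1 g') mu =
    s%:E * KL (marginal1 g) mu + (s * ln s + 1 - s)%:E.
  apply: KLZ => //.
  - by rewrite /= /marginal1 /pushforward preimage_setT; exact: probability_setT.
  - exact: probability_setT.
  - move=> A mA; rewrite /= /marginal1 /pushforward [LHS]g'E//.
    by rewrite -[X in measurable X]setTI; exact: measurable_fst.
have K2 : KL (marginal2 g') nu =
    s%:E * KL (marginal2 g) nu + (s * ln s + 1 - s)%:E.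
  apply: KLZ => //.
  - by rewrite /= /marginal2 /pushforward preimage_setT; exact: probability_setT.
  - exact: probability_setT.
  - move=> A mA; rewrite /= /marginal2 /pushforward [LHS]g'E//.
    by rewrite -[X in measurable X]setTI; exact: measurable_snd.
have F0 : (0 <= s * ln s + 1 - s)%R.
  by have := entropy_fun_ge0 s; rewrite /entropy_fun addrAC.
have L0 : 0 <= Lambda%:E by rewrite lee_fin ltW.
have I0 : 0 <= \int[g]_z (c z.1 z.2)%:E.
  by apply: integral_ge0 => z _; rewrite lee_fin.
(* Since [k1] and [k2] may be [+oo], distributivity rests on the nonnegativity of all terms, hence
   on [F0]. *)
have distr (I k1 k2 : \bar R) (t : R) :
    0 <= I -> 0 <= k1 -> 0 <= k2 -> (0 <= t)%R ->
    s%:E * I + Lambda%:E * (s%:E * k1 + t%:E) + Lambda%:E * (s%:E * k2 + t%:E) =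
    s%:E * (I + Lambda%:E * k1 + Lambda%:E * k2) + (2 * Lambda * t)%:E.
  move=> {}I0 k10 k20 t0.
  have sK (x : \bar R) : 0 <= x -> 0 <= s%:E * x by exact: mule_ge0.
  have LK (x : \bar R) : 0 <= x -> 0 <= Lambda%:E * x by exact: mule_ge0.
  rewrite !ge0_muleDr ?adde_ge0 ?LK ?sK// !(muleCA s%:E).
  have -> : (2 * Lambda * t)%:E = Lambda%:E * t%:E + Lambda%:E * t%:E.
    by rewrite -EFinM -EFinD; congr EFin; ring.
  by rewrite [LHS]addeACA -[X in _ + X = _]addeA [LHS]addeA [X in X + _ = _]addeAC.
by rewrite /entropy_transport cE K1 K2; apply: distr => //; exact: KL_ge0.
Qed.

End transport.

(** * A probability of finite energy *)

Section finite_energy.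
Context (R : realType) (d : nat).
Local Notation V := 'rV[R]_d.

Definition rV_box (r : R) : set V := [set v | forall i, `|v ord0 i| <= r]%R.

Lemma measurable_rV_box (r : R) : measurable (rV_box r).
Proof.
rewrite (_ : rV_box r = \bigcap_(i in [set: 'I_d])
    ((fun v : V => `|v ord0 i|%R) @^-1` `]-oo, r]%classic)).
  apply: fin_bigcap_measurable => // i _; rewrite -[X in measurable X]setTI.
  exact: (measurableT_comp (@normr_measurable R setT) (measurable_rV_coord i)).
by apply/seteqP; split => [v vr i _|v vr i]; [|have := vr i I];
  rewrite /= in_itv/=.
Qed.

(** Boxes of integer radius exhaust the space, so they cannot all be null. *)
Lemma probability_rV_box_gt0 (P : probability V R) :
  exists n : nat, 0 < P (rV_box n%:R).
Proof.
apply: contrapT => P0.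
have : P.-negligible (\bigcup_n rV_box n%:R).
  apply: negligible_bigcup => n; exists (rV_box n%:R); split => //.
    exact: measurable_rV_box.
  apply/eqP; rewrite eq_le measure_ge0 andbT leNgt.
  by apply/negP => ?; apply: P0; exists n.
have -> : \bigcup_n rV_box n%:R = setT.
  apply/seteqP; split => // v _; exists (Num.bound (\sum_i `|v ord0 i|)%R) => // i.
  rewrite (le_trans _ (ltW (archi_boundP _)))// ?sumr_ge0//.
  by rewrite (bigD1 i)//= lerDl sumr_ge0.
move/negligibleP => /(_ measurableT) /eqP.
by rewrite [X in X == _]probability_setT onee_eq0.
Qed.

Lemma entropy_transport_lty (mu nu : probability V R) (c : V -> V -> R)
    (Lambda : R) : (forall x y, (0 <= c x y)%R) -> (0 < Lambda)%R ->
  measurable_fun setT (fun z : V * V => c z.1 z.2) ->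
  (forall r : R, exists M, forall x y,
    rV_box r x -> rV_box r y -> (c x y <= M)%R) ->
  exists g : probability (V * V)%type R, entropy_transport c Lambda mu nu g < +oo.
Proof.
move=> c0 L0 mc cb.
have [n mun] := probability_rV_box_gt0 mu.
have [m num] := probability_rV_box_gt0 nu.
have [P P1 Pmu] := probability_condition_KL (measurable_rV_box _) mun.
have [Q Q1 Qnu] := probability_condition_KL (measurable_rV_box _) num.
(* [n + m] is a radius valid for both boxes. *)
have [M cM] := cb (n + m)%:R.
have mbox r := measurable_rV_box r.
pose g : probability (V * V)%type R := P \x Q.
have gX A B : measurable A -> measurable B -> g (A `*` B) = P A * Q B.
  exact: product_measure1E.
exists g; rewrite /entropy_transport.
have M1 : KL (marginal1 g) mu = KL P mu.
  apply: eq_KL.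
  - exact: probability_setT.
  - exact: probability_setT.
  - move=> A mA; rewrite /= /marginal1 /pushforward.
    rewrite (_ : _ @^-1` _ = A `*` setT); last by apply/seteqP; split => [z ?|z []].
    by rewrite [LHS]gX// [X in _ * X]probability_setT mule1.
have M2 : KL (marginal2 g) nu = KL Q nu.
  apply: eq_KL.
  - exact: probability_setT.
  - exact: probability_setT.
  - move=> A mA; rewrite /= /marginal2 /pushforward.
    rewrite (_ : _ @^-1` _ = setT `*` A); last by apply/seteqP; split => [z ?|z []].
    by rewrite [LHS]gX// [X in X * _]probability_setT mul1e.
have LK (x : \bar R) : x < +oo -> Lambda%:E * x < +oo.
  by apply: lte_mul_pinfty => //; rewrite lee_fin ltW.
rewrite M1 M2; apply: lte_add_pinfty; last exact: LK.
apply: lte_add_pinfty; last exact: LK.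
pose B := rV_box n%:R `*` rV_box m%:R : set (V * V)%type.
have mB : measurable B by exact: measurableX.
have PQB : g B = 1 by rewrite gX// P1 Q1 mule1.
have PQNB : g (~` B) = 0.
  have := probability_setC g mB; rewrite PQB.
  by rewrite subee.
apply: (@le_lt_trans _ _ (\int[g]_z M%:E)); last first.
  by rewrite integral_cst// [X in _ * X]probability_setT mule1 ltry.
have M0 : (0 <= M)%R.
  by apply: (le_trans (c0 0%R 0%R)); apply: cM => i; rewrite mxE normr0 ler0n.
apply: ae_ge0_le_integral => //.
- by move=> z _; rewrite lee_fin.
- exact/measurable_EFinP.
exists (~` B); split => //; first exact: measurableC.
move=> z /= zM Bz; apply: zM => ?; rewrite lee_fin cM//.
- by move=> i; rewrite (le_trans (Bz.1 i))// ler_nat leq_addr.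
- by move=> i; rewrite (le_trans (Bz.2 i))// ler_nat leq_addl.
Qed.

End finite_energy.

(* The total energy of [s *: gamma], where [a] is the energy of [gamma], in a
   form that displays its minimum over [s]. *)
Lemma entropy_costE (R : realType) (k a s : R) : (0 < k)%R -> (0 <= s)%R ->
  let z := expR (- (a / k)) in
  (s * a + k * (s * ln s + 1 - s) =
   k * (1 - z) + k * z * entropy_fun (s / z))%R.
Proof.
move=> k0 s0 z; have z0 : (0 < z)%R by exact: expR_gt0.
have aE : a = (- k * ln z)%R by rewrite expRK; field; rewrite gt_eqF.
rewrite [(s / z)%R]mulrC entropy_funZ ?invr_gt0// lnV ?posrE// aE /entropy_fun.
by field; rewrite gt_eqF.
Qed.

(** The last clause accounts for speaking of the solution: uniqueness passes from the unconstrained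
    problem to the constrained one. *)
Theorem theorem4 (R : realType) (d : nat)
    (mu nu : probability 'rV[R]_d R)
    (mu_ac : mu `<< lebesgue_rV R d) (nu_ac : nu `<< lebesgue_rV R d)
    (h : 'rV[R]_d -> R)
    (h_ge0 : forall z, (0 <= h z)%R) (h_convex : strictly_convex h)
    (Lambda : R) (Lambda_gt0 : (0 < Lambda)%R) :
  let E := entropy_transport (fun x y => h (x - y)%R) Lambda mu nu in
  let EP := fun gamma : probability ('rV[R]_d * 'rV[R]_d)%type R => E gamma in
  let Emin := ereal_inf (range EP) in
  let Z := expeR (- (Emin * ((2 * Lambda)^-1)%:E)) in
  forall tgamma : {finite_measure set ('rV[R]_d * 'rV[R]_d)%type -> \bar R},
    is_minimizer E tgamma ->
    exists gamma : probability ('rV[R]_d * 'rV[R]_d)%type R,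
      [/\ is_minimizer EP gamma,
          forall A, measurable A -> tgamma A = Z * gamma A
        & (forall tgamma' : {finite_measure set ('rV[R]_d * 'rV[R]_d)%type -> \bar R},
             is_minimizer E tgamma' ->
             forall A, measurable A -> tgamma' A = tgamma A) ->
          forall gamma' : probability ('rV[R]_d * 'rV[R]_d)%type R,
            is_minimizer EP gamma' ->
            forall A, measurable A -> gamma' A = gamma A].
Proof.
move=> E EP Emin Z tgamma tmin.
pose V := 'rV[R]_d; pose c (x y : V) : R := h (x - y)%R.
have c0 x y : (0 <= c x y)%R by exact: h_ge0.
have mc : measurable_fun setT (fun z : V * V => c z.1 z.2).
  apply: measurableT_comp; first exact: measurable_strictly_convex.
  apply: measurable_fun_rV => i; under eq_fun do rewrite !mxE.
  apply: measurable_funB.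
    exact: (measurableT_comp (measurable_rV_coord i) measurable_fst).
  exact: (measurableT_comp (measurable_rV_coord i) measurable_snd).
have cb (r : R) : exists M, forall x y, rV_box r x -> rV_box r y -> (c x y <= M)%R.
  (* The coordinates of [x - y] are bounded by twice the absolute value of [r]; adding 1 makes the
     radius positive. *)
  have r0 : (0 < 2 * `|r| + 1)%R by rewrite ltr_wpDl// mulr_ge0.
  have [M hM] := strictly_convex_bounded h_ge0 h_convex r0.
  exists M => x y xr yr; apply: hM => i; rewrite 2!mxE.
  have := ler_normB (x ord0 i) (y ord0 i); have := xr i; have := yr i.
  have := ler_norm r; lra.
have [g0 g0oo] := entropy_transport_lty mu nu c0 Lambda_gt0 mc cb.
pose k := (2 * Lambda)%R; have k0 : (0 < k)%R by rewrite mulr_gt0.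
pose z (a : R) := expR (- (a / k)).
have z0 a : (0 < z a)%R by exact: expR_gt0.
(* The least energy among multiples of a probability of energy [a], attained at mass [z a]. *)
pose psi (a : R) := (k * (1 - z a))%R.
have EZ (g : probability (V * V)%type R)
    (tg : {finite_measure set (V * V)%type -> \bar R}) (s a : R) : (0 <= s)%R ->
    (forall A, measurable A -> tg A = s%:E * g A) -> EP g = a%:E ->
    E tg = (psi a + k * z a * entropy_fun (s / z a))%:E.
  move=> s0 tgE ga; rewrite /E (entropy_transportZ mu nu c0 Lambda_gt0 mc s0 tgE).
  have := ga; rewrite /EP /E => ->; rewrite -EFinM -EFinD.
  by rewrite entropy_costE.
have Efin (g : {finite_measure set (V * V)%type -> \bar R}) : E g < +oo ->
    E g = (fine (E g))%:E.
  by move=> goo; rewrite fineK// ge0_fin_numE// entropy_transport_ge0.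
have tle tg : E tgamma <= E tg by rewrite tmin; apply: ereal_inf_lbound; exists tg.
have tpsi (g : probability (V * V)%type R) a :
    EP g = a%:E -> E tgamma <= (psi a)%:E.
  move=> ga; apply: (le_trans (tle (mscale (NngNum (ltW (z0 a))) g))).
  rewrite (EZ g _ (z a) a)//; last exact: ltW.
  by rewrite divff ?gt_eqF// entropy_fun1 mulr0 addr0.
pose m := fine (tgamma setT).
(* [g0] is the default value for a null [tgamma], a case excluded below by [m_gt0]. *)
pose gamma : probability (V * V)%type R := mnormalize tgamma g0.
have m0 : (0 <= m)%R by rewrite fine_ge0.
have tfin : tgamma setT \is a fin_num by exact: fin_num_measure.
have tgE A : measurable A -> tgamma A = m%:E * gamma A.
  move=> mA; rewrite /gamma /= /mnormalize /=.
  rewrite (_ : (_ == +oo) = false) ?orbF; last first.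
    by apply/negbTE; rewrite -ltey ltey_eq tfin.
  case: ifPn => [/eqP t0|t0].
    rewrite /m t0 mul0e; apply/eqP; rewrite eq_le measure_ge0 andbT -t0.
    by apply: le_measure; rewrite ?inE.
  by rewrite muleCA -EFinM divff ?mule1// fine_eq0.
have mE := entropy_transportZ mu nu c0 Lambda_gt0 mc m0 tgE.
(* [k] is the energy of the null measure. Being strictly below it rules out zero mass, and also
   infinite energy of [gamma]. *)
have t2L : E tgamma < k%:E.
  apply: (le_lt_trans (tpsi _ _ (Efin _ g0oo))).
  by rewrite lte_fin /psi; have := z0 (fine (E g0)); nra.
have m_gt0 : (0 < m)%R.
  rewrite lt_def m0 andbT; apply/eqP => m_0; move: t2L.
  by rewrite /E mE m_0 mul0e mul0r !add0r subr0 mulr1 ltxx.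
have goo : E gamma < +oo.
  rewrite ltey; apply/eqP => goo; move: t2L.
  by rewrite /E mE; move: goo; rewrite /E => ->; rewrite gt0_muley ?lte_fin// addye.
have ga := Efin _ goo; set a := fine (E gamma) in ga.
have tE := EZ gamma tgamma m a m0 tgE ga.
(* For [g'] of finite energy, [E tgamma] lies between [psi a] and [psi] at the energy of [g'], and
   [psi] is increasing. *)
have gmin : is_minimizer EP gamma.
  apply/eqP; rewrite eq_le; apply/andP; split; last first.
    by apply: ereal_inf_lbound; exists gamma.
  apply: le_ereal_inf_tmp => _ [g' _ <-]; rewrite /EP ga.
  have [g'oo|] := ltP (E g') +oo; last by rewrite leye_eq => /eqP ->; rewrite leey.
  have g'a := Efin _ g'oo; rewrite g'a lee_fin.
  have := tpsi _ _ g'a; rewrite tE lee_fin => le_psi.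
  have : (0 <= k * z a * entropy_fun (m / z a))%R.
    by rewrite !mulr_ge0 ?entropy_fun_ge0// ltW.
  move=> F0; have : (psi a <= psi (fine (E g')))%R.
    by apply: le_trans le_psi; rewrite lerDl.
  by rewrite /psi ler_pM2l// lerD2l lerN2 ler_expR lerN2 ler_pM2r ?invr_gt0.
(* [E tgamma] is at most [psi a], so the nonnegative excess vanishes, which happens only at ratio
   1. *)
have mz : m = z a.
  have := tpsi _ _ ga; rewrite tE lee_fin gerDl pmulr_rle0 ?mulr_gt0// => F0.
  have [/(congr1 ( *%R^~ (z a)))|/entropy_fun_gt0] := eqVneq (m / z a)%R 1%R.
    by rewrite mul1r divfK ?gt_eqF.
  by rewrite ltNge F0.
have ZE : Z = m%:E.
  by rewrite /Z /Emin -gmin /EP ga -EFinM /= mz.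
exists gamma; split => // [A mA|uniq g' g'min A mA]; first by rewrite ZE tgE.
have g'a : EP g' = a%:E by rewrite g'min -gmin.
(* [tg'] has the energy of [tgamma], so uniqueness identifies [m] times [g'] with [m] times [gamma],
   and [m] cancels. *)
pose tg' := mscale (NngNum m0) g'.
have tg'min : is_minimizer E tg'.
  by rewrite /is_minimizer -tmin tE; exact: EZ g'a.
have /(congr1 (fun x => m^-1%:E * x)) := uniq _ tg'min A mA.
rewrite tgE// /tg' /= /mscale /= !muleA -EFinM mulVf ?gt_eqF//.
by rewrite !mul1e.
Qed.
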